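(* Let $1\le k_1\le k_2$ be integers, $n=k_1+k_2$, and let $\mathsf{N}$ be the $n\times n$ nilpotent matrix in Jordan normal form with two Jordan blocks, of sizes $k_1$ and $k_2$. Let $\nabla_{\bar{\mathsf{M}}}$ be the operator defined in the context, and let $$G_{\nabla_{\bar{\mathsf{M}}}}(1,t)=2+\sum_{d\ge1}\dim\left(\ker\nabla_{\bar{\mathsf{M}}}\cap(P_d\otimes\mathbb{R}^n)\right)t^d .$$ Then $$G_{\nabla_{\bar{\mathsf{M}}}}(1,t)=\frac{2}{(1-t)^{k_1+k_2}}-\sum_{i=1}^{k_2-k_1}\frac{t}{(1-t)^i}.$$
   Context: $P_d$ is the space of real homogeneous polynomials of degree $d$ in $x_1,\dots,x_n$, and $P_d\otimes\mathbb{R}^n$ is regarded as the space of homogeneous polynomial maps $\mathbb{R}^n\to\mathbb{R}^n$ of degree $d$. For a matrix $A$, $(A\varphi)(x)=A\varphi(x)$ and $(A_\star\varphi)(x)=\varphi(Ax)$. Let $\mathsf{M}=\mathsf{N}^t$, let $p$ be the nilpotency index of $\mathsf{N}$ (the least $p$ with $\mathsf{N}^p=0$, here $p=k_2$), and put $$\bar{\mathsf{M}}=\sum_{i=1}^{p-1}\sum_{l=0}^{i-1}\mathsf{N}^{l}\mathsf{M}^{i}\mathsf{N}^{i-l-1},\qquad \bar{\mathsf{M}}_\star=\sum_{i=1}^{p-1}\sum_{l=0}^{i-1}(\mathsf{N}_\star)^{l}(\mathsf{M}_\star)^{i}(\mathsf{N}_\star)^{i-l-1},\qquad \nabla_{\bar{\mathsf{M}}}=\bar{\mathsf{M}}-\bar{\mathsf{M}}_\star,$$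 with empty sums equal to zero (here $\bar{\mathsf{M}}_\star$ is given by this formula, not by substitution of the matrix $\bar{\mathsf{M}}$). The constant term $2$ in the generating function is a convention: it counts the two elements of $\ker\mathsf{M}$ in degree $0$. *)

(* Defs.v *)
From HB Require Import structures.
From mathcomp Require Import all_boot all_order all_algebra.
From mathcomp Require Import boolp reals.
From mathcomp Require Import mpoly.

Set Implicit Arguments.
Unset Strict Implicit.
Unset Printing Implicit Defensive.

Import GRing.Theory.
Local Open Scope ring_scope.

(* The ring K[[t]] of formal power series; f n is the coefficient of t ^ n.   *)
Record fps (K : comNzRingType) := Fps { fps_coef :> nat -> K }.

Section FormalPowerSeries.
Variable K : comNzRingType.
Implicit Types f g h : fps K.

HB.instance Definition _ := gen_eqMixin (fps K).
HB.instance Definition _ := gen_choiceMixin (fps K).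

Lemma fpsP f g : (forall n, f n = g n) -> f = g.
Proof. by case: f g => f [g] /= fg; congr Fps; apply/funext. Qed.

Definition fps_zero : fps K := Fps (fun=> 0).
Definition fps_opp f : fps K := Fps (fun n => - f n).
Definition fps_add f g : fps K := Fps (fun n => f n + g n).
Definition fps_one : fps K := Fps (fun n => (n == 0%N)%:R).
Definition fps_mul f g : fps K :=
  Fps (fun n => \sum_(i < n.+1) f i * g (n - i)%N).

Fact fps_addA : associative fps_add.
Proof. by move=> f g h; apply: fpsP => n /=; rewrite addrA. Qed.

Fact fps_addC : commutative fps_add.
Proof. by move=> f g; apply: fpsP => n /=; rewrite addrC. Qed.

Fact fps_add0 : left_id fps_zero fps_add.
Proof. by move=> f; apply: fpsP => n /=; rewrite add0r. Qed.

Fact fps_addN : left_inverse fps_zero fps_opp fps_add.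
Proof. by move=> f; apply: fpsP => n /=; rewrite addNr. Qed.

HB.instance Definition _ :=
  GRing.isZmodule.Build (fps K) fps_addA fps_addC fps_add0 fps_addN.

Definition fps_trunc m f : {poly K} := \poly_(i < m) f i.

Fact fps_mulE m f g (p q : {poly K}) :
    (forall i, (i < m)%N -> p`_i = f i) ->
    (forall i, (i < m)%N -> q`_i = g i) ->
  forall n, (n < m)%N -> (p * q)`_n = fps_mul f g n.
Proof.
move=> pf qg n nm; rewrite coefM /=; apply: eq_bigr => i _.
have im: (i < m)%N by rewrite (leq_trans (ltn_ord i)).
by rewrite pf // qg // (leq_ltn_trans (leq_subr _ _)).
Qed.

Fact fps_truncE m f i : (i < m)%N -> (fps_trunc m f)`_i = f i.
Proof. by move=> im; rewrite coef_poly im. Qed.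

Fact fps_mulA : associative fps_mul.
Proof.
move=> f g h; apply: fpsP => n.
pose p x := fps_trunc n.+1 x.
have pE x i : (i < n.+1)%N -> (p x)`_i = x i by apply: fps_truncE.
rewrite -(@fps_mulE n.+1 f (fps_mul g h) (p f) (p g * p h)) //.
- rewrite -(@fps_mulE n.+1 (fps_mul f g) h (p f * p g) (p h)) ?mulrA //.
  + by apply: fps_mulE; apply: pE.
  + exact: pE.
- exact: pE.
- by apply: fps_mulE; apply: pE.
Qed.

Fact fps_mulC : commutative fps_mul.
Proof.
move=> f g; apply: fpsP => n; have pE x i := @fps_truncE n.+1 x i.
rewrite -(fps_mulE (pE f) (pE g)) // mulrC.
by rewrite (fps_mulE (pE g) (pE f)).
Qed.

Fact fps_mul1 : left_id fps_one fps_mul.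
Proof.
move=> f; apply: fpsP => n /=; rewrite big_ord_recl /= mul1r subn0.
by rewrite big1 ?addr0 // => i _; rewrite mul0r.
Qed.

Fact fps_mulDl : left_distributive fps_mul fps_add.
Proof.
move=> f g h; apply: fpsP => n /=; rewrite -big_split.
by apply: eq_bigr => i _; rewrite mulrDl.
Qed.

Fact fps_one_neq0 : fps_one != 0 :> fps K.
Proof.
by apply/eqP => /(congr1 (fun f : fps K => f 0%N)) /= /eqP; rewrite oner_eq0.
Qed.

HB.instance Definition _ := GRing.Zmodule_isComNzRing.Build (fps K)
  fps_mulA fps_mulC fps_mul1 fps_mulDl fps_one_neq0.

Definition fps_unit : pred (fps K) := fun f => `[< exists g, g * f = 1 >].

(* As for every unitRingType, the inverse of a non-unit is itself by          *)
(* convention.                                                                *)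
Definition fps_inv f : fps K :=
  if pselect (exists g, g * f = 1) is left ex then sval (cid ex) else f.

Fact fps_mulVf : {in fps_unit, left_inverse 1 fps_inv *%R}.
Proof.
move=> f /asboolP uf; rewrite /fps_inv.
by case: pselect => // ex; case: (cid ex).
Qed.

Fact fps_unitP f g : g * f = 1 -> fps_unit f.
Proof. by move=> gf; apply/asboolP; exists g. Qed.

Fact fps_inv_out : {in [predC fps_unit], fps_inv =1 id}.
Proof.
move=> f /negP nuf; rewrite /fps_inv.
by case: pselect => // ex; case: nuf; apply/asboolP.
Qed.

HB.instance Definition _ := GRing.ComNzRing_hasMulInverse.Build (fps K)
  fps_mulVf fps_unitP fps_inv_out.

Definition fpsX : fps K := Fps (fun n => (n == 1%N)%:R).

End FormalPowerSeries.

(* P_d. The library makes dhomog n F d a vectType only when n is a successor; *)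
(* this alias carries the structure for every n.                              *)
Definition hpoly (F : fieldType) (n d : nat) := dhomog n F d.

Section HomogeneousPolynomials.
Variable F : fieldType.

HB.instance Definition _ n d := GRing.Lmodule.on (hpoly F n d).

Definition hpoly_dim n d : nat :=
  if n is n'.+1 then 'C(d + n', d) else (d == 0)%N.

Fact hpoly_vecaxiom n d : Vector.axiom (hpoly_dim n d) (hpoly F n d).
Proof.
case: n => [|n]; last exact: dhomog_vecaxiom.
have m0 (m : 'X_{1..0}) : m = 0%MM by apply/mnmP; case.
pose f (p : hpoly F 0 d) : 'rV[F]_(d == 0%N) := const_mx (mpoly_of_dhomog p)@_0%MM.
exists f.
  by move=> a p q; apply/rowP => j; rewrite !mxE /= mcoeffD mcoeffZ.
have [d0|dN0] := eqVneq d 0%N.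
  have gP (r : 'rV[F]_(d == 0%N)) :
      (\sum_j r 0 j)%:MP_[0%N] \is [in F[0], d.-homog].
    by move: (\sum_j _) => c; rewrite d0; apply: nvar0_homog.
  exists (fun r => DHomog (gP r)).
    move=> p; apply: val_inj => /=; apply/mpolyP => m.
    rewrite (m0 m) mcoeffC eqxx mulr1 /f.
    rewrite (eq_bigr (fun=> (mpoly_of_dhomog p)@_0%MM)).
      by rewrite sumr_const card_ord (introT eqP d0).
    by move=> j _; rewrite mxE.
  move=> r; apply/rowP => j; rewrite mxE /= mcoeffC eqxx mulr1.
  rewrite (bigD1 j) //= big1 ?addr0 // => i /eqP[]; apply: val_inj.
  case: i j => [i +] [j +]; rewrite d0 /= !ltnS !leqn0.
  by move=> /eqP -> /eqP ->.
exists (fun=> 0).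
  move=> p; apply: val_inj => /=; apply/mpolyP => m.
  rewrite mcoeff0 (@dhomog_nemf_coeff _ _ mdeg d) ?(valP p) //.
  by rewrite (m0 m) mf0 eq_sym.
by move=> r; apply/rowP => -[j lj]; exfalso; move: lj; rewrite /= (negbTE dN0).
Qed.

HB.instance Definition _ n d :=
  Lmodule_hasFinDim.Build F (hpoly F n d) (@hpoly_vecaxiom n d).

(* P_d (x) F^n: phi i is the i-th component of the polynomial map phi.        *)
Definition hmap n d := {ffun 'I_n -> hpoly F n d}.

HB.instance Definition _ n d := Vector.on (hmap n d).

(* The linear forms (A x)_i.                                                  *)
Definition lin_forms n (A : 'M[F]_n) : n.-tuple {mpoly F[n]} :=
  [tuple \sum_j A i j *: 'X_j | i < n].

Fact lin_subst_homog n d (A : 'M[F]_n) (f : hpoly F n d) :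
  mpoly_of_dhomog f \mPo lin_forms A \is [in F[n], d.-homog].
Proof.
rewrite comp_mpolyE big_seq rpred_sum // => m mf; rewrite rpredZ //.
have <- : mdeg m = d.
  by have /dhomogP/(_ m mf) := valP f.
rewrite mdegE; elim/big_ind2: _ => [|e p e' p' hp hp'|i _].
- exact: dhomog1.
- exact: dhomogM.
suff h1 : tnth (lin_forms A) i \is 1.-homog.
  by have := dhomogMn (m i) h1; rewrite mul1n.
rewrite tnth_mktuple.
by rewrite rpred_sum // => j _; rewrite rpredZ // dhomogX; apply/eqP/mdeg1.
Qed.

Definition hpoly_subst n d (A : 'M[F]_n) (f : hpoly F n d) : hpoly F n d :=
  DHomog (lin_subst_homog A f).

(* (A phi)(x) = A phi(x)                                                      *)
Definition mx_act n d (A : 'M[F]_n) (phi : hmap n d) : hmap n d :=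
  [ffun i => \sum_j A i j *: phi j].

(* (A_star phi)(x) = phi(A x)                                                 *)
Definition star_act n d (A : 'M[F]_n) (phi : hmap n d) : hmap n d :=
  [ffun i => hpoly_subst A (phi i)].

Fact mx_act_is_linear n d (A : 'M[F]_n) : linear (@mx_act n d A).
Proof.
move=> a u v; apply/ffunP => i; rewrite !ffunE scaler_sumr -big_split.
apply: eq_bigr => j _; rewrite !ffunE scalerDr !scalerA.
by rewrite [A i j * a]mulrC.
Qed.

HB.instance Definition _ n d A := GRing.isLinear.Build F (hmap n d) (hmap n d)
  *:%R (@mx_act n d A) (mx_act_is_linear A).

Fact star_act_is_linear n d (A : 'M[F]_n) : linear (@star_act n d A).
Proof.
move=> a u v; apply/ffunP => i; rewrite !ffunE; apply: val_inj => /=.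
by rewrite linearP.
Qed.

HB.instance Definition _ n d A := GRing.isLinear.Build F (hmap n d) (hmap n d)
  *:%R (@star_act n d A) (star_act_is_linear A).

End HomogeneousPolynomials.

Section Nabla.
Variable F : fieldType.

Definition Mbar n (N : 'M[F]_n) (p : nat) : 'M[F]_n :=
  \sum_(1 <= i < p) \sum_(0 <= l < i)
    N ^+ l *m N^T ^+ i *m N ^+ (i - l - 1).

Definition Mbar_star n d (N : 'M[F]_n) (p : nat) (phi : hmap F n d) :
    hmap F n d :=
  \sum_(1 <= i < p) \sum_(0 <= l < i)
    iter l (star_act N) (iter i (star_act N^T)
      (iter (i - l - 1) (star_act N) phi)).

Definition nabla_Mbar n d (N : 'M[F]_n) (p : nat) (phi : hmap F n d) :
    hmap F n d :=
  mx_act (Mbar N p) phi - Mbar_star N p phi.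

Fact iter_linear (V : lmodType F) (f : {linear V -> V}) m : linear (iter m f).
Proof. by elim: m => [//|m IH] a u v; rewrite !iterS IH linearP. Qed.

Fact Mbar_star_is_linear n d (N : 'M[F]_n) p : linear (@Mbar_star n d N p).
Proof.
move=> a u v; rewrite /Mbar_star scaler_sumr -big_split; apply: eq_bigr => i _.
rewrite scaler_sumr -big_split; apply: eq_bigr => l _ /=.
by rewrite !(iter_linear (@star_act F n d N)) (iter_linear (@star_act F n d N^T))
  iter_linear.
Qed.

Fact nabla_Mbar_is_linear n d (N : 'M[F]_n) p : linear (@nabla_Mbar n d N p).
Proof.
move=> a u v; rewrite /nabla_Mbar Mbar_star_is_linear linearP /=.
by rewrite scalerBr opprD addrACA.
Qed.

HB.instance Definition _ n d N p :=
  GRing.isLinear.Build F (hmap F n d) (hmap F n d) *:%R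
    (@nabla_Mbar n d N p) (nabla_Mbar_is_linear N p).

Definition jordan_block k : 'M[F]_k := \matrix_(i, j) (i.+1 == j)%:R.

Definition jordan2 k1 k2 : 'M[F]_(k1 + k2) :=
  block_mx (jordan_block k1) 0 0 (jordan_block k2).

Fact jordan2_nilpotent k1 k2 : exists p, jordan2 k1 k2 ^+ p == 0.
Proof.
have strict (i j : 'I_(k1 + k2)) : (j <= i)%N -> jordan2 k1 k2 i j = 0.
  move=> ji; rewrite /jordan2 mxE; case: (split_ordP i) => i' def_i;
  rewrite mxE; case: (split_ordP j) => j' def_j; rewrite !mxE //;
  move: ji; rewrite def_i def_j /= ?leq_add2l => ji;
  by case: eqP ji => // <-; rewrite ltnn.
have pow m (i j : 'I_(k1 + k2)) : (j < i + m)%N -> (jordan2 k1 k2 ^+ m) i j = 0.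
  elim: m j => [|m IH] j ji.
    by rewrite expr0 mxE; case: eqP ji => // ->; rewrite addn0 ltnn.
  rewrite exprSr mxE big1 // => l _; have [lm|ml] := ltnP l (i + m).
    by rewrite IH ?mul0r.
  rewrite strict ?mulr0 // (leq_trans _ ml) // -ltnS.
  by rewrite addnS in ji.
exists (k1 + k2)%N; apply/eqP/matrixP => i j; rewrite pow ?mxE //.
by rewrite ltn_addl.
Qed.

Definition nilp_index k1 k2 : nat := ex_minn (jordan2_nilpotent k1 k2).

(* The generating function, as an element of Z[[t]].                          *)
Definition gen_ker_nabla k1 k2 : fps int :=
  Fps (fun d => if d is 0 then 2 else
    (\dim (lker (linfun
      (@nabla_Mbar (k1 + k2) d (jordan2 k1 k2) (nilp_index k1 k2)))))%:Z).

End Nabla.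

(* Main.v *)
Require Import Defs.
From HB Require Import structures.
From mathcomp Require Import all_boot all_order all_algebra.
From mathcomp Require Import boolp reals zify.
From mathcomp Require Import mpoly.

Set Implicit Arguments.
Unset Strict Implicit.
Unset Printing Implicit Defensive.

Import Order.TTheory GRing.Theory Num.Theory.
Local Open Scope ring_scope.

(* On vector components as well as on monomials, N and M = N^T act as mutually
   inverse partial injections, so every term N^l M^i N^(i-l-1) agrees with M
   wherever it does not vanish: both bars are M with positive integer weights.
   An element phi of ker nabla thus satisfies L phi_i = w_i phi_(i-1) in each
   Jordan block (L phi_0 = 0 for the first component), where L is the bar of
   M_star on scalar polynomials.  It is determined by the last components of
   the two blocks, which range over ker L^k1 x ker L^k2.  For d > 0, L^k2 = 0,
   and L^k1 f = 0 iff the coefficients of f at the monomials in the last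
   k2 - k1 variables vanish, whence
     dim ker nabla = 2 dim P_d(k1 + k2) - dim P_d(k2 - k1).
   Finally sum_(i = 1)^r t / (1 - t)^i = 1 / (1 - t)^r - 1. *)

(** * Partial injections and their iterates *)

Definition pinverse (I : eqType) (a b : I -> option I) :=
  forall x y, (a x == Some y) = (b y == Some x).

Section PartialMaps.
Variables (I : eqType) (a b : I -> option I).

Lemma iter_obind_None n : iter n (obind a) None = None.
Proof. by elim: n => //= n ->. Qed.

Lemma iter_pinverse n x y : pinverse a b ->
  iter n (obind a) (Some x) = Some y -> iter n (obind b) (Some y) = Some x.
Proof.
move=> ab; elim: n y => [|n IH] y; first by case=> ->.
rewrite iterS; case E: (iter n _ _) => [z|//] /= /eqP.
by rewrite ab => /eqP byz; rewrite -iterS iterSr /= byz; apply: IH.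
Qed.

Lemma eval_iter_pull (X : Type) (V : nmodType) (ev : X -> I -> V) (A : X -> X) :
    (forall f x, ev (A f) x = oapp (ev f) 0 (a x)) ->
  forall n f o,
    oapp (ev (iter n A f)) 0 o = oapp (ev f) 0 (iter n (obind a) o).
Proof.
move=> evA; elim=> [//|n IH] f [x|]; last by rewrite iter_obind_None.
by rewrite [iter _ A f]iterS iterSr /= evA IH.
Qed.

End PartialMaps.

(** * The bar of a partial injection as a weighted step *)

Section Weights.
Variables (I : eqType) (a b : I -> option I).
Hypothesis ab : pinverse a b.

(** The index at which [B^l A^i B^(i-l-1) f], evaluated at [x], reads [f]: under pullback the
    leftmost factor moves first. *)
Definition mbar_path i l x :=
  iter (i - l - 1) (obind b) (iter i (obind a) (iter l (obind b) (Some x))).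

Definition mbar_weight p x : nat :=
  \sum_(1 <= i < p) \sum_(0 <= l < i) isSome (mbar_path i l x).

(* After l steps along b, the first l of the i steps along a lead back to x,
   and the last i - l - 1 steps along b undo all but one of the others. *)
Lemma mbar_pathE i l x : (l < i)%N ->
  mbar_path i l x = if isSome (mbar_path i l x) then a x else None.
Proof.
have ba : pinverse b a by move=> y z; rewrite ab.
move=> li; rewrite /mbar_path; set c := (i - l - 1)%N.
have -> : i = (c.+1 + l)%N by rewrite /c -subnDA addn1 -subSn // subSS subnK // ltnW.
rewrite iterD; case E: (iter l (obind b) _) => [y|]; last by rewrite !iter_obind_None.
rewrite (iter_pinverse ba E) iterSr /=.
case E1: (a x) => [z|]; last by rewrite !iter_obind_None.
case E2: (iter c (obind a) _) => [t|]; last by rewrite !iter_obind_None.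
by rewrite (iter_pinverse ab E2).
Qed.

(** The term [i = 1], [l = 0] contributes 1, its path being the single step [a x]. *)
Lemma mbar_weight_gt0 p x : (1 < p)%N -> a x -> (0 < mbar_weight p x)%N.
Proof.
move=> p1; rewrite /mbar_weight big_ltn // big_nat1 /mbar_path /=.
by case: (a x).
Qed.

(** [ev] is a component of a map in [mx_act_Mbar] and a coefficient of a polynomial in
    [hcoef_scalar_Mbar], so one computation serves both bars. *)
Lemma eval_mbar (X : Type) (V : nmodType) (ev : X -> I -> V) (A B : X -> X) :
    (forall f x, ev (A f) x = oapp (ev f) 0 (a x)) ->
    (forall f x, ev (B f) x = oapp (ev f) 0 (b x)) ->
  forall p f x,
    \sum_(1 <= i < p) \sum_(0 <= l < i)
        ev (iter l B (iter i A (iter (i - l - 1) B f))) x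
      = oapp (ev f) 0 (a x) *+ mbar_weight p x.
Proof.
move=> evA evB p f x; rewrite /mbar_weight -sumrMnr; apply: eq_bigr => i _.
rewrite -sumrMnr; apply: eq_big_nat => l /andP[_ li].
transitivity (oapp (ev f) 0 (mbar_path i l x)).
  have := eval_iter_pull evB l (iter i A (iter (i - l - 1) B f)) (Some x).
  by rewrite /= => ->; rewrite (eval_iter_pull evA) (eval_iter_pull evB).
by rewrite {1}mbar_pathE //; case: (isSome _).
Qed.

End Weights.

(** * Monomials under substitution by a partial injection *)

Section MonomialShift.
Variable n : nat.
Implicit Types (m : 'X_{1..n}) (e : 'I_n -> option 'I_n).

(* The image of 'X_[m] under x_i |-> x_(e i), where e i = None encodes
   x_i |-> 0 and the value None encodes 0; e' is the partial inverse of e. *)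
Definition mshift e e' m : option 'X_{1..n} :=
  if [forall i, (e i == None) ==> (m i == 0)%N]
  then Some [multinom oapp m 0%N (e' j) | j < n] else None.

Lemma mshift_Some e e' m m' : mshift e e' m = Some m' ->
  forall j, m' j = oapp m 0%N (e' j).
Proof. by rewrite /mshift; case: ifP => // _ [<-] j; rewrite mnmE. Qed.

(** Where the shift is defined no exponent is lost: the variables killed by [e] have exponent 0, and
    the places outside the domain of [e'] receive the default 0. *)
Lemma mshift_pinverse e e' :
  pinverse e e' -> pinverse (mshift e e') (mshift e' e).
Proof.
move=> ee'.
suff S e1 e2 m m' : pinverse e1 e2 ->
    mshift e1 e2 m = Some m' -> mshift e2 e1 m' = Some m.
  have e'e : pinverse e' e by move=> x y; rewrite ee'.
  by move=> m m'; apply/eqP/eqP; apply: S.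
move=> e12; rewrite /mshift; case: ifP => // /forallP m0 [<-].
case: ifP => [_|/negbT]; last first.
  by rewrite negb_forall => /existsP[j]; rewrite negb_imply mnmE => /andP[/eqP->].
congr Some; apply/mnmP => i; rewrite mnmE.
case E: (e1 i) => [j|] /=.
  by rewrite mnmE; move/eqP: E; rewrite e12 => /eqP ->.
by have := m0 i; rewrite E eqxx => /eqP.
Qed.

End MonomialShift.

Definition pmx (F : fieldType) n (e : 'I_n -> option 'I_n) : 'M[F]_n :=
  \matrix_(i, j) (e i == Some j)%:R.

Lemma sum_option (V : nmodType) (I : finType) (o : option I) (f : I -> V) :
  \sum_i f i *+ (o == Some i) = oapp f 0 o.
Proof.
case: o => [i|]; last by rewrite big1.
rewrite (bigD1 i) //= eqxx big1 ?addr0 // => j ji.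
by rewrite (inj_eq Some_inj) eq_sym (negbTE ji).
Qed.

Section ShiftSubstitution.
Variables (F : fieldType) (n : nat) (e e' : 'I_n -> option 'I_n).
Hypothesis ee' : pinverse e e'.

Lemma prod_pmx_forms (m : 'X_{1..n}) :
  \prod_i tnth (lin_forms (pmx F e)) i ^+ m i
    = oapp (fun k => 'X_[k]) 0 (mshift e e' m).
Proof.
have lE i : tnth (lin_forms (pmx F e)) i = oapp (fun j => 'X_j) 0 (e i).
  rewrite tnth_mktuple -sum_option; apply: eq_bigr => j _.
  by rewrite mxE scaler_nat.
rewrite /mshift; case: ifP => [/forallP m0|/negbT]; last first.
  rewrite negb_forall => /existsP[i]; rewrite negb_imply => /andP[/eqP ei mi].
  by rewrite (bigD1 i) //= lE ei /= expr0n (negbTE mi) mul0r.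
transitivity ('X_[\sum_i (oapp (fun j => U_(j)) 0 (e i) *+ m i)%MM] : {mpoly F[n]}).
  rewrite -mprodXE; apply: eq_bigr => i _; rewrite lE.
  case E: (e i) => [j|] /=; first by rewrite mpolyXn.
  by have := m0 i; rewrite E eqxx => /eqP ->; rewrite mulm0n mpolyX0 expr0.
congr ('X_[_]); apply/mnmP => j; rewrite mnm_sumE mnmE -sum_option.
apply: eq_bigr => i _; rewrite mulmnE -ee'.
case: (e i) => [k|] /=; last by rewrite mnm0E.
by rewrite mnm1E (inj_eq Some_inj); case: eqP; rewrite ?mul1n ?mul0n.
Qed.

(** Distinct monomials never have the same nonzero image, so the coefficient at [m] has at most one
    source, found by shifting backwards. *)
Lemma mcoeff_pmx_subst (f : {mpoly F[n]}) m :
  (f \mPo lin_forms (pmx F e))@_m = oapp (fun k => f@_k) 0 (mshift e' e m).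
Proof.
have -> : oapp (fun k => f@_k) 0 (mshift e' e m) =
    \sum_(k <- msupp f) f@_k *+ (mshift e' e m == Some k).
  case: (mshift e' e m) => [k0|] /=; last by rewrite big1.
  rewrite {1}[f]mpolyE raddf_sum; apply: eq_bigr => k _ /=.
  by rewrite mcoeffZ mcoeffX mulr_natr eq_sym.
rewrite comp_mpolyE raddf_sum; apply: eq_bigr => k _ /=.
rewrite prod_pmx_forms mcoeffZ -(mshift_pinverse ee').
case: (mshift e e' k) => [k'|] /=; last by rewrite mcoeff0 mulr0.
by rewrite mcoeffX mulr_natr.
Qed.

End ShiftSubstitution.

(** * The two bars on components and on coefficients *)

Section ScalarMbar.
Variables (F : fieldType) (n d : nat).

Fact hpoly_subst_is_linear A : linear (@hpoly_subst F n d A).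
Proof. by move=> a u v; apply: val_inj; rewrite /= linearP. Qed.

HB.instance Definition _ A :=
  GRing.isLinear.Build F (hpoly F n d) (hpoly F n d) *:%R (@hpoly_subst F n d A)
    (hpoly_subst_is_linear A).

(** The operator [L] of the overview, through which [Mbar_star] acts on each component. *)
Definition scalar_Mbar (N : 'M[F]_n) p (f : hpoly F n d) : hpoly F n d :=
  \sum_(1 <= i < p) \sum_(0 <= l < i)
    iter l (hpoly_subst N) (iter i (hpoly_subst N^T)
      (iter (i - l - 1) (hpoly_subst N) f)).

Fact scalar_Mbar_is_linear N p : linear (scalar_Mbar N p).
Proof.
move=> a u v; rewrite /scalar_Mbar scaler_sumr -big_split; apply: eq_bigr => i _.
rewrite scaler_sumr -big_split; apply: eq_bigr => l _ /=.
by rewrite !(iter_linear (hpoly_subst N)) (iter_linear (hpoly_subst N^T))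
  iter_linear.
Qed.

HB.instance Definition _ N p :=
  GRing.isLinear.Build F (hpoly F n d) (hpoly F n d) *:%R (scalar_Mbar N p)
    (scalar_Mbar_is_linear N p).

Lemma iter_star_actE (A : 'M[F]_n) k (phi : hmap F n d) i :
  iter k (star_act A) phi i = iter k (hpoly_subst A) (phi i).
Proof. by elim: k => //= k IH; rewrite ffunE IH. Qed.

Lemma Mbar_starE N p (phi : hmap F n d) i :
  Mbar_star N p phi i = scalar_Mbar N p (phi i).
Proof.
rewrite /Mbar_star sum_ffunE; apply: eq_bigr => k _; rewrite sum_ffunE.
by apply: eq_bigr => l _; rewrite !iter_star_actE.
Qed.

Lemma mx_actM (A B : 'M[F]_n) (phi : hmap F n d) :
  mx_act (A *m B) phi = mx_act A (mx_act B phi).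
Proof.
apply/ffunP => i; rewrite !ffunE.
under eq_bigr => j _ do rewrite mxE scaler_suml.
rewrite exchange_big /=; apply: eq_bigr => j _; rewrite ffunE scaler_sumr.
by apply: eq_bigr => k _; rewrite scalerA.
Qed.

Lemma mx_actX (A : 'M[F]_n) k (phi : hmap F n d) :
  mx_act (A ^+ k) phi = iter k (mx_act A) phi.
Proof.
elim: k => [|k IH]; last by rewrite exprS mx_actM IH.
apply/ffunP => i; rewrite ffunE (bigD1 i) //= big1 => [|j ji].
  by rewrite mxE eqxx scale1r addr0.
by rewrite mxE eq_sym (negbTE ji) scale0r.
Qed.

Lemma mx_act_sum (I : Type) (r : seq I) (A : I -> 'M[F]_n) (phi : hmap F n d) :
  mx_act (\sum_(i <- r) A i) phi = \sum_(i <- r) mx_act (A i) phi.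
Proof.
apply/ffunP => i; rewrite sum_ffunE !ffunE.
under eq_bigr => j _ do rewrite summxE scaler_suml.
by rewrite exchange_big; apply: eq_bigr => k _; rewrite ffunE.
Qed.

Variables (e e' : 'I_n -> option 'I_n).
Hypothesis ee' : pinverse e e'.

Lemma pmx_tr : (pmx F e)^T = pmx F e'.
Proof. by apply/matrixP => i j; rewrite !mxE ee'. Qed.

Lemma mx_act_pmx a (phi : hmap F n d) i :
  mx_act (pmx F a) phi i = oapp phi 0 (a i).
Proof.
rewrite ffunE -sum_option; apply: eq_bigr => j _.
by rewrite mxE scaler_nat.
Qed.

Let e'e : pinverse e' e. Proof. by move=> x y; rewrite ee'. Qed.

Lemma mx_act_Mbar p (phi : hmap F n d) i :
  mx_act (Mbar (pmx F e) p) phi i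
    = oapp phi 0 (e' i) *+ mbar_weight e' e p i.
Proof.
rewrite -(eval_mbar e'e (ev := fun f : hmap F n d => f : 'I_n -> _)
  (mx_act_pmx e') (mx_act_pmx e)).
rewrite /Mbar mx_act_sum sum_ffunE; apply: eq_bigr => k _.
rewrite mx_act_sum sum_ffunE; apply: eq_bigr => l _.
by rewrite !mx_actM !mx_actX pmx_tr.
Qed.

Definition hcoef (f : hpoly F n d) m : F := (mpoly_of_dhomog f)@_m.

Lemma hcoef_sum (I : Type) (r : seq I) (f : I -> hpoly F n d) m :
  hcoef (\sum_(i <- r) f i) m = \sum_(i <- r) hcoef (f i) m.
Proof.
rewrite /hcoef; elim: r => [|x r IH]; first by rewrite !big_nil /= mcoeff0.
by rewrite !big_cons /= mcoeffD IH.
Qed.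

(** Reading coefficients reverses direction: substitution by [pmx F e'], the transpose, pulls back
    along [mshift e e']. *)
Lemma hcoef_scalar_Mbar p f m :
  hcoef (scalar_Mbar (pmx F e) p f) m
    = oapp (hcoef f) 0 (mshift e e' m)
      *+ mbar_weight (mshift e e') (mshift e' e) p m.
Proof.
rewrite -(eval_mbar (mshift_pinverse ee') (ev := hcoef)
  (A := hpoly_subst (pmx F e')) (B := hpoly_subst (pmx F e))).
- rewrite hcoef_sum; apply: eq_bigr => i _; rewrite hcoef_sum.
  by apply: eq_bigr => l _; rewrite pmx_tr.
- by move=> g k; rewrite /hcoef /= (mcoeff_pmx_subst e'e).
- by move=> g k; rewrite /hcoef /= (mcoeff_pmx_subst ee').
Qed.

Lemma hcoef_deg (f : hpoly F n d) m : mdeg m != d -> hcoef f m = 0.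
Proof. exact/dhomog_nemf_coeff/(valP f). Qed.

Lemma hpoly_eq0P (f : hpoly F n d) : (forall m, hcoef f m = 0) <-> f = 0.
Proof.
split=> [f0|-> m]; last by rewrite /hcoef /= mcoeff0.
by apply: val_inj; apply/mpolyP => m; rewrite /= mcoeff0; apply: f0.
Qed.

End ScalarMbar.

(** * Kernels in characteristic zero, where positive weights cancel *)

Section CharacteristicZero.
Variables (F : numFieldType).

Lemma mulrn_eq0_gt0 (V : lmodType F) (v : V) w :
  (0 < w)%N -> (v *+ w == 0) = (v == 0).
Proof.
by move=> w0; rewrite -scaler_nat scaler_eq0 pnatr_eq0 eqn0Ngt w0.
Qed.

Section ScalarMbarKernel.
Variables (n d p : nat) (e e' : 'I_n -> option 'I_n).
Hypotheses (ee' : pinverse e e') (d0 : (0 < d)%N).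
Hypothesis p1 : forall j, e' j -> (1 < p)%N.

Local Notation L := (@scalar_Mbar F n d (pmx F e) p).

Lemma hcoef_scalar_Mbar_eq0 f m :
  (hcoef (L f) m == 0) = (oapp (hcoef f) 0 (mshift e e' m) == 0).
Proof.
rewrite (hcoef_scalar_Mbar ee').
case E: (mshift e e' m) => [m'|] /=; last by rewrite mul0rn.
have [/existsP[j m'j]|m'0] := boolP [exists j, m' j != 0%N].
  rewrite (mulrn_eq0_gt0 (V := F^o)) // mbar_weight_gt0 ?E //.
  apply: (p1 (j := j)); move: m'j; rewrite (mshift_Some E).
  by case: (e' j).
(* Here [p > 1] is not guaranteed and the weight may be 0, but [m'] is the zero monomial, whose
   coefficient vanishes because [d > 0]. *)
rewrite hcoef_deg ?mul0rn //.
suff -> : m' = 0%MM by rewrite mdeg0 eq_sym -lt0n.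
apply/mnmP => j; rewrite mnm0E; apply/eqP.
by move: m'0; rewrite negb_exists => /forallP/(_ j)/negPn.
Qed.

(** The weights drop out of the iterated vanishing criterion: only the monomials reached by [k]
    shifts matter. *)
Lemma iter_scalar_Mbar_eq0P k f :
  iter k L f = 0 <->
  forall m, oapp (hcoef f) 0 (iter k (obind (mshift e e')) (Some m)) = 0.
Proof.
have E o : (oapp (hcoef (iter k L f)) 0 o == 0) =
    (oapp (hcoef f) 0 (iter k (obind (mshift e e')) o) == 0).
  elim: k o => [//|k IH] [m|]; last by rewrite iter_obind_None eqxx.
  by rewrite [LHS]hcoef_scalar_Mbar_eq0 IH iterSr.
rewrite -hpoly_eq0P; split=> f0 m; apply/eqP.
  by rewrite -E /= f0.
by have := E (Some m); rewrite /= f0 eqxx.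
Qed.

End ScalarMbarKernel.

(* The equations satisfied by the components of an element of the kernel of
   nabla in one Jordan block of size k.+1. *)
Section BlockRecursion.
Variables (V : lmodType F) (L : {linear V -> V}) (w : nat -> nat).

Definition block_rec k (g : nat -> V) :=
  L (g 0%N) = 0 /\ forall t, (t < k)%N -> L (g t.+1) = g t *+ w t.+1.

(** Descending: [g t.+1 = 0] forces [g t *+ w t.+1 = 0], and the weight cancels. *)
Lemma block_rec_eq0 k g : (forall t, (t < k)%N -> (0 < w t.+1)%N) ->
  block_rec k g -> g k = 0 -> forall t, (t <= k)%N -> g t = 0.
Proof.
elim: k => [_ _ g0 t|k IH w0 [L0 LS] gk t]; first by rewrite leqn0 => /eqP ->.
rewrite leq_eqVlt => /predU1P[-> //|]; rewrite ltnS; apply: IH.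
- by move=> s sk; rewrite w0 // ltnW.
- by split=> // s sk; rewrite LS // ltnW.
- by apply/eqP; rewrite -(mulrn_eq0_gt0 _ (w0 k _)) // -LS // gk linear0.
Qed.

Lemma iter_block_rec k g : block_rec k g -> iter k.+1 L (g k) = 0.
Proof.
elim: k => [[]//|k IH [L0 LS]]; rewrite iterSr LS // -scaler_nat.
have Z m c u : iter m L (c *: u) = c *: iter m L u.
  by elim: m => //= m ->; rewrite linearZ.
by rewrite Z IH ?scaler0 //; split=> // s sk; rewrite LS // ltnW.
Qed.

Lemma block_rec_ex k u : (forall t, (t < k)%N -> (0 < w t.+1)%N) ->
  iter k.+1 L u = 0 -> exists2 g, block_rec k g & g k = u.
Proof.
elim: k u => [|k IH] u w0; first by move=> u0; exists (fun=> u).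
rewrite iterSr => Lu.
have wk : (w k.+1)%:R != 0 :> F by rewrite pnatr_eq0 -lt0n w0.
have Z m c v : iter m L (c *: v) = c *: iter m L v.
  by elim: m => //= m ->; rewrite linearZ.
(* The last equation [L u = g k *+ w k.+1] forces this value of [g k]. *)
have [||g [L0 LS] gk] := IH ((w k.+1)%:R^-1 *: L u).
- by move=> t tk; rewrite w0 // ltnW.
- by rewrite Z Lu scaler0.
exists (fun t => if t == k.+1 then u else g t); last by rewrite eqxx.
split=> // t; rewrite ltnS eqSS => tk.
rewrite [t == k.+1]ltn_eqF ?ltnS //.
move: tk; rewrite leq_eqVlt; case: eqVneq => [-> _|_ /= tk].
  by rewrite gk -scaler_nat scalerA divff // scale1r.
by rewrite LS.
Qed.

End BlockRecursion.
End CharacteristicZero.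

(** Totalised so that the block recursions can use indices such as [k1 + t] without bound proofs. *)
Definition ord_ext (T : Type) (z : T) n (f : 'I_n -> T) (t : nat) : T :=
  oapp f z (insub t).

Lemma ord_extE (T : Type) (z : T) n (f : 'I_n -> T) (i : 'I_n) :
  ord_ext z f i = f i.
Proof. by rewrite /ord_ext valK. Qed.

Lemma ord_ext_out (T : Type) (z : T) n (f : 'I_n -> T) t :
  (n <= t)%N -> ord_ext z f t = z.
Proof. by move=> nt; rewrite /ord_ext insubN // -leqNgt. Qed.

(** * The shift defined by two Jordan blocks *)

Section JordanShift.
Variables k1 k2 : nat.
Local Notation n := (k1 + k2)%N.

(** Both block ends give [None]: the first by the test on [k1], the second because [insub] rejects
    [n]. *)
Definition jnext (i : 'I_n) : option 'I_n :=
  if i.+1 == k1 then None else insub i.+1.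

Definition jprev (i : 'I_n) : option 'I_n :=
  if (i == 0%N :> nat) || (i == k1 :> nat) then None else insub i.-1.

Lemma insub_eq_Some (t : nat) (j : 'I_n) :
  (insub t == Some j :> option 'I_n) = (t == j).
Proof.
case: insubP => [i _ <-|]; first by rewrite (inj_eq Some_inj).
by move=> tn; apply/esym/eqP => tj; rewrite tj ltn_ord in tn.
Qed.

Lemma jnextE i j : (jnext i == Some j) = (i.+1 == j) && (j != k1 :> nat).
Proof.
rewrite /jnext; case: (eqVneq i.+1 k1) => [ik|ik].
  by apply/esym/negbTE; rewrite ik eq_sym andbN.
by rewrite insub_eq_Some; case: (i.+1 =P j) => // <-; rewrite ik.
Qed.

Lemma jnext_pinverse : pinverse jnext jprev.
Proof.
move=> i j; rewrite jnextE /jprev; case: j => -[|j] lj //=.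
case: (eqVneq j.+1 k1) => [_|_]; first by rewrite andbF.
by rewrite insub_eq_Some andbT eqSS eq_sym.
Qed.

Lemma jordan2E (F : fieldType) : jordan2 F k1 k2 = pmx F jnext.
Proof.
apply/matrixP => i j; rewrite !mxE jnextE.
(* Writing 0 as [1 *+ 0] turns all four block cases into comparisons of truth values. *)
case: (split_ordP i) => i' ->; rewrite mxE;
  case: (split_ordP j) => j' ->; rewrite !mxE /= -?(mulr0n 1); congr (_ *+ _);
  have := ltn_ord i'; have := ltn_ord j'; lia.
Qed.

Lemma ord_ext_jprev (V : nmodType) (f : 'I_n -> V) (i : 'I_n) :
  oapp f 0 (jprev i) =
    if (i == 0%N :> nat) || (i == k1 :> nat) then 0 else ord_ext 0 f i.-1.
Proof. by rewrite /jprev; case: ifP. Qed.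

(** A defined [jprev j] exhibits an entry 1 of the Jordan matrix, excluding index 1; index 0 is
    excluded because the identity is nonzero. *)
Lemma nilp_index_gt1 (F : fieldType) j :
  jprev j -> (1 < nilp_index F k1 k2)%N.
Proof.
rewrite /nilp_index; case: ex_minnP => p Np _.
case Ej: (jprev j) => [i|//] _.
have ij : jordan2 F k1 k2 i j = 1.
  by rewrite jordan2E mxE jnext_pinverse Ej eqxx.
case: p Np => [|[|//]] /eqP/matrixP.
  by move/(_ i i)/eqP; rewrite !mxE eqxx oner_eq0.
by move/(_ i j)/eqP; rewrite expr1 ij mxE oner_eq0.
Qed.

(** With [r = k2 - k1] and [s = k1 + k1] these are the monomials in the last [k2 - k1] variables. *)
Definition mpad r s (mu : 'X_{1..r}) : 'X_{1..n} :=
  [multinom if (s <= i)%N then ord_ext 0%N mu (i - s) else 0%N | i < n].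

Lemma mpad_at r s (mu : 'X_{1..r}) (i : 'I_n) (j : 'I_r) :
  i = (s + j)%N :> nat -> mpad s mu i = mu j.
Proof. by move=> ij; rewrite mnmE ij leq_addr addKn ord_extE. Qed.

Lemma mpad_inj r s : (s + r <= n)%N -> injective (@mpad r s).
Proof.
move=> srn mu nu E; apply/mnmP => j.
have jn : (s + j < n)%N by rewrite (leq_trans _ srn) // ltn_add2l.
by rewrite -(@mpad_at r s mu (Ordinal jn)) // E (@mpad_at _ _ _ _ j).
Qed.

Lemma mdeg_mpad r s (mu : 'X_{1..r}) :
  (s + r <= n)%N -> mdeg (mpad s mu) = mdeg mu.
Proof.
move=> srn; rewrite !mdegE.
pose G i := (if (s <= i)%N then ord_ext 0%N mu (i - s) else 0%N).
transitivity (\sum_(0 <= i < n) G i)%N.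
  by rewrite big_mkord; apply: eq_bigr => i _; rewrite mnmE.
rewrite (big_cat_nat (n := s)) //=; last exact: leq_trans (leq_addr _ _) srn.
rewrite big_nat big1 => [|i /andP[_ si]]; last by rewrite /G leqNgt si.
rewrite add0n (big_cat_nat (n := (s + r)%N)) ?leq_addr //=.
have -> : (\sum_(s + r <= i < n) G i = 0)%N.
  rewrite big_nat big1 // => i /andP[si _].
  by rewrite /G; case: ifP => // _; rewrite ord_ext_out //; lia.
rewrite addn0 -{1}[s]add0n big_addn addKn big_mkord.
by apply: eq_bigr => i _; rewrite /G leq_addl addnK ord_extE.
Qed.

(** The window of [r] variables lies in the second block and stops before its last variable, so
    nothing is killed. *)
Lemma mshift_mpad r s (mu : 'X_{1..r}) : (k1 <= s)%N -> (s + r < n)%N ->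
  mshift jnext jprev (mpad s mu) = Some (mpad s.+1 mu).
Proof.
move=> ks srn; rewrite /mshift; case: ifP => [_|/negP[]].
  congr Some; apply/mnmP => j; rewrite !mnmE /jprev.
  case: ifP => /= [jk|jk]; first by case: ifP => //; lia.
  case: insubP => [i _ ij|]; last by have := ltn_ord j; lia.
  rewrite /= mnmE ij; have -> : (s <= j.-1)%N = (s < j)%N by lia.
  by have -> : (j.-1 - s)%N = (j - s.+1)%N by lia.
apply/forallP => i; apply/implyP; rewrite /jnext mnmE.
case: ifP => ik; first by case: ifP => //; lia.
case: insubP => // ni _; case: ifP => // si.
by rewrite ord_ext_out //; lia.
Qed.

Lemma iter_mshift_mpad r s t (mu : 'X_{1..r}) :
    (k1 <= s)%N -> (s + t + r <= n)%N ->
  iter t (obind (mshift jnext jprev)) (Some (mpad s mu))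
    = Some (mpad (s + t) mu).
Proof.
move=> ks; elim: t => [|t IH] h; first by rewrite addn0.
by rewrite iterS IH /= ?mshift_mpad ?addnS //; lia.
Qed.

(** Each shift empties one more place at the start of each block. *)
Lemma iter_mshift_supp t o m :
    iter t (obind (mshift jnext jprev)) o = Some m ->
  forall i : 'I_n, (i < t)%N || (k1 <= i < k1 + t)%N -> m i = 0%N.
Proof.
elim: t m => [|t IH] m; first by move=> _ i; lia.
rewrite iterS; case E: (iter t _ _) => [m'|//] /= /mshift_Some mE i it.
rewrite mE /jprev; case: ifP => // ik.
case: insubP => //= i' _ i'i; apply: (IH _ E); lia.
Qed.

End JordanShift.

(** * The dimension of the kernel in positive degree *)

Section Dimension.
Variables (F : numFieldType) (k1 k2 d : nat).
Hypotheses (k1_gt0 : (0 < k1)%N) (k12 : (k1 <= k2)%N) (d_gt0 : (0 < d)%N).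
Local Notation n := (k1 + k2)%N.
Local Notation r := (k2 - k1)%N.
Local Notation p := (nilp_index F k1 k2).
Local Notation e := (@jnext k1 k2).
Local Notation e' := (@jprev k1 k2).
Local Notation V := (hpoly F n d).
Local Notation W := (hpoly F r d).
Local Notation N := (pmx F e).
Local Notation L := (@scalar_Mbar F n d N p).
Local Notation pad := (@mpad k1 k2 r (k1 + k1)).

Let ee' : pinverse e e' := @jnext_pinverse k1 k2.

Fact tail_homog (f : V) :
  \sum_(mu : 'X_{1..r < d.+1} | mdeg mu == d) hcoef f (pad mu) *: 'X_[mu]
    \is [in F[r], d.-homog].
Proof.
by rewrite rpred_sum // => mu mud; rewrite rpredZ // dhomogX.
Qed.

(** Restriction of [f] to the subspace where the first [k1 + k1] coordinates vanish. *)
Definition tail_coefs (f : V) : W := DHomog (tail_homog f).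

Lemma hcoef_tail f mu : hcoef (tail_coefs f) mu = hcoef f (pad mu).
Proof.
have [mud|mud] := eqVneq (mdeg mu) d; last first.
  by rewrite !hcoef_deg // mdeg_mpad //; lia.
have lmu : (mdeg mu < d.+1)%N by rewrite mud.
rewrite {1}/hcoef /= raddf_sum (bigD1 (BMultinom lmu)) /= ?mud //.
rewrite mcoeffZ mcoeffX eqxx mulr1 big1 ?addr0 // => nu /andP[_].
by rewrite bmeqP /= mcoeffZ mcoeffX => /negbTE ->; rewrite mulr0.
Qed.

Lemma hcoef_inj m (f g : hpoly F m d) : hcoef f =1 hcoef g -> f = g.
Proof. by move=> fg; apply: val_inj; apply/mpolyP => k; apply: fg. Qed.

Fact tail_coefs_is_linear : linear tail_coefs.
Proof.
move=> a u v; apply: hcoef_inj => mu.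
have P m (f g : hpoly F m d) k : hcoef (a *: f + g) k = a * hcoef f k + hcoef g k.
  by rewrite /hcoef /= mcoeffD mcoeffZ.
by rewrite P !hcoef_tail P.
Qed.

HB.instance Definition _ :=
  GRing.isLinear.Build F V W *:%R tail_coefs tail_coefs_is_linear.

Lemma tail_coefs_surj g : exists f, tail_coefs f = g.
Proof.
have H : \sum_(mu : 'X_{1..r < d.+1} | mdeg mu == d) hcoef g mu *: 'X_[pad mu]
    \is [in F[n], d.-homog].
  rewrite rpred_sum // => mu mud; rewrite rpredZ // dhomogX /=.
  by rewrite mdeg_mpad //; lia.
exists (DHomog H); apply: hcoef_inj => mu; rewrite hcoef_tail.
have [mud|mud] := eqVneq (mdeg mu) d; last first.
  by rewrite !hcoef_deg // mdeg_mpad //; lia.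
have lmu : (mdeg mu < d.+1)%N by rewrite mud.
rewrite {1}/hcoef /= raddf_sum (bigD1 (BMultinom lmu)) /= ?mud //.
rewrite mcoeffZ mcoeffX eqxx mulr1 big1 ?addr0 // => nu /andP[_].
rewrite bmeqP /= mcoeffZ mcoeffX (inj_eq (mpad_inj _)) => [/negbTE ->|].
  by rewrite mulr0.
by lia.
Qed.

(** The monomials reached by [k1] shifts are those in the last [k2 - k1] variables: the first block
    is emptied, and so are the first [k1] places of the second. *)
Lemma iter_scalar_Mbar_k1 f : iter k1 L f = 0 <-> tail_coefs f = 0.
Proof.
rewrite (iter_scalar_Mbar_eq0P ee' d_gt0 (@nilp_index_gt1 k1 k2 F)).
rewrite -hpoly_eq0P; split=> f0 => [mu|m].
  (* [pad mu] is reached in [k1] shifts from the window at the start of the second block. *)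
  rewrite hcoef_tail; have := f0 (@mpad k1 k2 r k1 mu).
  by rewrite iter_mshift_mpad //; lia.
case E: (iter _ _ _) => [m'|//] /=.
pose mu : 'X_{1..r} := [multinom ord_ext 0%N m' (k1 + k1 + i) | i < r].
have -> : m' = pad mu; last by rewrite -hcoef_tail.
apply/mnmP => i; rewrite mnmE; case: ifP => ki; last first.
  by rewrite (iter_mshift_supp E) //; lia.
have ir : (i - (k1 + k1) < r)%N by have := ltn_ord i; lia.
by rewrite -[(i - _)%N]/(val (Ordinal ir)) ord_extE mnmE /= subnKC // ord_extE.
Qed.

(** Since [k1 <= k2], that many shifts empty both blocks, leaving only the zero monomial, which has
    degree 0. *)
Lemma iter_scalar_Mbar_k2 f : iter k2 L f = 0.
Proof.
apply/(iter_scalar_Mbar_eq0P ee' d_gt0 (@nilp_index_gt1 k1 k2 F)) => m.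
case E: (iter _ _ _) => [m'|//] /=; rewrite hcoef_deg //.
suff -> : m' = 0%MM by rewrite mdeg0 eq_sym -lt0n.
apply/mnmP => i; rewrite mnm0E (iter_mshift_supp E) //.
by have := ltn_ord i; lia.
Qed.

Local Notation w := (mbar_weight e' e p).
Let w_ext (t : nat) : nat := ord_ext 0%N w t.

Lemma nabla_Mbar_eq0P (phi : hmap F n d) :
  nabla_Mbar (jordan2 F k1 k2) p phi = 0 <->
    block_rec L w_ext k1.-1 (ord_ext 0 phi) /\
    block_rec L (fun t => w_ext (k1 + t)) k2.-1
      (fun t => ord_ext 0 phi (k1 + t)).
Proof.
have E i : nabla_Mbar (jordan2 F k1 k2) p phi i =
    (if (i == 0%N :> nat) || (i == k1 :> nat) then 0 else ord_ext 0 phi i.-1)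
      *+ w i - L (phi i).
  transitivity (mx_act (Mbar (jordan2 F k1 k2) p) phi i
      - Mbar_star (jordan2 F k1 k2) p phi i); first by rewrite !ffunE.
  by rewrite jordan2E (mx_act_Mbar ee') ord_ext_jprev Mbar_starE.
set g := ord_ext 0 phi.
(* The equations are first put on one range of natural indices, then cut at [k1]; [t = 0] and
   [t = k1] become the initial equations of the blocks. *)
have {E}-> : nabla_Mbar (jordan2 F k1 k2) p phi = 0 <-> forall t, (t < n)%N ->
    L (g t) = (if (t == 0%N) || (t == k1) then 0 else g t.-1) *+ w_ext t.
  split=> [nab0 t tn|H].
    have := E (Ordinal tn); rewrite nab0 ffunE => /eqP.
    rewrite eq_sym subr_eq0 => /eqP.
    by rewrite -(ord_extE 0 phi) -(ord_extE 0%N w).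
  apply/ffunP => i; rewrite E ffunE; apply/eqP; rewrite subr_eq0.
  by rewrite -(ord_extE 0 phi) H // /w_ext ord_extE.
split=> [H|[[H10 H1] [H20 H2]] t tn].
  split; split=> [|t tk] /=.
  - by rewrite H ?mul0rn //; lia.
  - by rewrite H /= ?ltn_eqF //; lia.
  - by rewrite H ?addn0 ?eqxx ?orbT ?mul0rn //; lia.
  - rewrite H; last by lia.
    by rewrite addnS /= -[X in _ == X]addn0 -addnS eqn_add2l.
have [tk|kt] := ltnP t k1.
  case: t tk tn => [|t] tk tn; first by rewrite H10 mul0rn.
  by rewrite H1 /= ?ltn_eqF //; lia.
rewrite -(subnKC kt); case E: (t - k1)%N => [|s].
  by rewrite H20 addn0 eqxx orbT mul0rn.
rewrite H2; last by lia.
by rewrite addnS /= -[X in _ == X]addn0 -addnS eqn_add2l.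
Qed.

Let last1 : 'I_n := Ordinal (ltac:(lia) : (k1.-1 < n)%N).
Let last2 : 'I_n := Ordinal (ltac:(lia) : (k1 + k2.-1 < n)%N).

Definition last_comps (phi : hmap F n d) : V * V := (phi last1, phi last2).

Fact last_comps_is_linear : linear last_comps.
Proof. by move=> a u v; rewrite /last_comps !ffunE. Qed.

HB.instance Definition _ :=
  GRing.isLinear.Build F (hmap F n d) (V * V)%type *:%R last_comps
    last_comps_is_linear.

(** Its kernel is [ker L^k1 x V]; the second factor is unconstrained because [L^k2 = 0]. *)
Definition tail_fst (u : V * V) : W := tail_coefs u.1.

Fact tail_fst_is_linear : linear tail_fst.
Proof. by move=> a u v; rewrite /tail_fst /= linearP. Qed.

HB.instance Definition _ :=
  GRing.isLinear.Build F (V * V)%type W *:%R tail_fst tail_fst_is_linear.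

Let w_ext_gt0 t : (t < n)%N -> t != 0%N -> t != k1 -> (0 < w_ext t)%N.
Proof.
move=> tn t0 tk; rewrite /w_ext -[t]/(val (Ordinal tn)) ord_extE.
have e't : e' (Ordinal tn).
  rewrite /jprev /= (negbTE t0) (negbTE tk) /=; case: insubP => //; lia.
by rewrite mbar_weight_gt0 // (nilp_index_gt1 F e't).
Qed.

Let w1_gt0 t : (t < k1.-1)%N -> (0 < w_ext t.+1)%N.
Proof. by move=> tk; rewrite w_ext_gt0 //; lia. Qed.

Let w2_gt0 t : (t < k2.-1)%N -> (0 < w_ext (k1 + t.+1))%N.
Proof. by move=> tk; rewrite w_ext_gt0 //; lia. Qed.

Local Notation nabla := (linfun (@nabla_Mbar F n d (jordan2 F k1 k2) p)).

Lemma last_comps_ker_inj : (lker nabla :&: lker (linfun last_comps) = 0)%VS.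
Proof.
apply/eqP; rewrite -subv0; apply/subvP => phi.
rewrite memv_cap memv0 !memv_ker !lfunE /= => /andP[/eqP/nabla_Mbar_eq0P[B1 B2]].
case/eqP => p1 p2.
have Z1 := block_rec_eq0 w1_gt0 B1.
have Z2 := block_rec_eq0 w2_gt0 B2.
apply/eqP/ffunP => i; rewrite ffunE -(ord_extE 0 phi).
have [ik|ki] := ltnP i k1.
  by apply: Z1; [exact: etrans (ord_extE 0 phi last1) p1 | lia].
rewrite -(subnKC ki); apply: Z2; last by have := ltn_ord i; lia.
exact: etrans (ord_extE 0 phi last2) p2.
Qed.

Lemma last_comps_ker_img :
  (linfun last_comps @: lker nabla = lker (linfun tail_fst))%VS.
Proof.
apply/vspaceP => -[u v]; apply/memv_imgP/idP => [[phi]|].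
  rewrite memv_ker !lfunE /= => /eqP/nabla_Mbar_eq0P[/iter_block_rec B1 _].
  move=> [-> _]; rewrite memv_ker lfunE /=; apply/eqP/iter_scalar_Mbar_k1.
  by move: B1; rewrite prednK // -[k1.-1]/(val last1) ord_extE.
rewrite memv_ker lfunE /= => /eqP/iter_scalar_Mbar_k1 Lu.
have {}Lu : iter k1.-1.+1 L u = 0 by rewrite prednK.
have Lv : iter k2.-1.+1 L v = 0.
  by rewrite prednK ?iter_scalar_Mbar_k2 //; lia.
have [g1 B1 gu] := block_rec_ex w1_gt0 Lu.
have [g2 B2 gv] := block_rec_ex (w := fun t => w_ext (k1 + t)) w2_gt0 Lv.
(* The solutions on the two blocks are glued into one map. *)
pose G t := if (t < k1)%N then g1 t else g2 (t - k1)%N.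
pose phi : hmap F n d := [ffun i => G (val i)].
have phiE t : (t < n)%N -> ord_ext 0 phi t = G t.
  by move=> tn; rewrite -[t]/(val (Ordinal tn)) ord_extE ffunE.
have GE t : G (k1 + t)%N = g2 t by rewrite /G addKn ltnNge leq_addr.
exists phi.
  rewrite memv_ker lfunE /=; apply/eqP/nabla_Mbar_eq0P.
  case: B1 B2 => [B10 B1] [B20 B2].
  split; split=> [|t tk]; rewrite ?phiE ?GE ?B20 ?B2 //; try lia.
  - by rewrite /G k1_gt0.
  - rewrite /G.
    have -> : (t.+1 < k1)%N by lia.
    have -> : (t < k1)%N by lia.
    exact: B1.
rewrite lfunE; congr (_, _); rewrite ffunE /= ?GE //.
by rewrite /G; have -> : (k1.-1 < k1)%N by lia.
Qed.

(** Rank-nullity twice: [last_comps] is injective on the kernel with image [lker (linfun tail_fst)],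
    and [tail_fst] maps [V * V] onto [W]. The additive form avoids truncated subtraction. *)
Lemma dim_ker_nabla :
  (\dim (lker nabla) + hpoly_dim r d = hpoly_dim n d + hpoly_dim n d)%N.
Proof.
rewrite -(limg_ker_dim (linfun last_comps) (lker nabla)).
rewrite last_comps_ker_inj dimv0 add0n last_comps_ker_img.
have := limg_ker_dim (linfun tail_fst) fullv; rewrite capfv.
have -> : (linfun tail_fst @: fullv = fullv)%VS.
  apply/vspaceP => g; rewrite memvf; have [f fg] := tail_coefs_surj g.
  by apply/memv_imgP; exists (f, 0); rewrite ?memvf // lfunE.
by rewrite !dimvf.
Qed.

End Dimension.

(** * Hilbert series and the closed form *)

Section GeneratingFunction.

(** The Hilbert series of the polynomial ring in [n] variables. *)
Definition hpoly_series n : fps int := Fps (fun d => (hpoly_dim n d)%:Z).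

Local Notation t := (fpsX int).

Lemma fps_coefB (f g : fps int) d : (f - g) d = f d - g d.
Proof. by []. Qed.

Lemma fps_coefXM (f : fps int) d :
  (t * f) d = if d is d'.+1 then f d' else 0.
Proof.
case: d => [|d]; first by rewrite [LHS]big_ord1 mul0r.
rewrite [LHS]big_ord_recl mul0r add0r big_ord_recl /= mul1r subSS subn0.
by rewrite big1 ?addr0 // => i _; rewrite mul0r.
Qed.

Lemma hpoly_series0 : hpoly_series 0 = 1.
Proof. by apply: fpsP => -[|d]. Qed.

(** Pascal's rule in each positive degree; [n = 0] is separate because [hpoly_dim 0] is not given by
    a binomial. *)
Lemma hpoly_seriesS n : (1 - t) * hpoly_series n.+1 = hpoly_series n.
Proof.
apply: fpsP => d; rewrite mulrBl mul1r fps_coefB fps_coefXM.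
case: d => [|d]; first by case: n => [|n]; rewrite /= subr0 ?bin0.
case: n => [|n]; first by rewrite /= !addn0 !binn subrr.
by rewrite /= addSn binS addnS PoszD addrK.
Qed.

Lemma hpoly_seriesM n : hpoly_series n * (1 - t) ^+ n = 1.
Proof.
elim: n => [|n IH]; first by rewrite expr0 mulr1 hpoly_series0.
by rewrite exprS mulrA [_ * (1 - t)]mulrC hpoly_seriesS.
Qed.

Lemma hpoly_seriesE n : hpoly_series n = 1 / (1 - t) ^+ n.
Proof.
(* Invertibility makes the quotient a true one, not the default value of [fps_inv] at a non-unit. *)
have U : (1 - t) ^+ n \is a GRing.unit.
  by apply/unitrP; exists (hpoly_series n); rewrite [X in _ /\ X = _]mulrC hpoly_seriesM.
exact: canRL (mulrK U) (hpoly_seriesM n).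
Qed.

(** Telescoping: by [hpoly_seriesS], [t * hpoly_series r.+1] is the difference of two consecutive
    series. *)
Lemma sum_X_div_pow r :
  \sum_(1 <= i < r.+1) t / (1 - t) ^+ i = hpoly_series r - 1.
Proof.
elim: r => [|r IH]; first by rewrite big_nil hpoly_series0 subrr.
rewrite big_nat_recr //= IH -[X in t * X]mul1r -hpoly_seriesE -(hpoly_seriesS r).
by rewrite mulrBl mul1r addrAC subrK.
Qed.

End GeneratingFunction.

Theorem mainTheorem7 (R : realType) (k1 k2 : nat)
    (hk1 : (1 <= k1)%N) (hk12 : (k1 <= k2)%N) :
  let t : fps int := fpsX int in
  gen_ker_nabla R k1 k2 =
    2%:R / (1 - t) ^+ (k1 + k2)
      - \sum_(1 <= i < (k2 - k1).+1) t / (1 - t) ^+ i.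
Proof.
move=> t; rewrite sum_X_div_pow -[2%:R]mulr1 -mulrA -hpoly_seriesE.
rewrite mulr_natl mulr2n; apply: fpsP => -[|d].
  (* In degree 0 every series has coefficient 1, so the right side is [1 + 1 - (1 - 1)], the
     conventional 2. *)
  by case: (k1 + k2)%N (k2 - k1)%N => [|n] [|r]; rewrite /= ?bin0.
have := @dim_ker_nabla R k1 k2 d.+1 hk1 hk12 isT.
move=> /(congr1 Posz); rewrite !PoszD => /(canRL (addrK _)) /= ->.
by rewrite subr0.
Qed.
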